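(* For all positive integers $x$ and $n$, \[ x^n \;=\; x+\sum_{s=1}^{m}\frac{2\cdot n!}{(2s)!\,(n-2s)!}\sum_{k=1}^{x-1}\sum_{j=1}^{k} j^{\,n-2s}, \] where $m=\frac{n}{2}$ if $n$ is even and $m=\frac{n-1}{2}$ if $n$ is odd.
   Context: An empty sum (upper index smaller than lower index) equals $0$. *)

(* Defs.v *)
From mathcomp Require Export all_boot all_order all_algebra.

Set Implicit Arguments.
Unset Strict Implicit.
Unset Printing Implicit Defensive.

(* Main.v *)
Require Import Defs.
From mathcomp Require Import all_boot all_order all_algebra.
From mathcomp Require Import ring zify.
Set Implicit Arguments.
Unset Strict Implicit.
Unset Printing Implicit Defensive.
Import Order.TTheory GRing.Theory Num.Theory.
Local Open Scope ring_scope.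

(** The odd terms of the binomial expansions cancel in the second difference
    [(j + 1)^n - 2 j^n + (j - 1)^n], leaving the sum over [s >= 1] of
    [2 'C(n, 2 s) j^(n - 2 s)].  Summing over [1 <= j <= k] telescopes to
    [(k + 1)^n - k^n - 1], and then over [1 <= k < x] to [x^n - x]. *)

(** Passing from [n] to [n.+1] adds a term on either side only when [n] is odd. *)
Lemma sum_even_nat (V : nmodType) (F : nat -> V) (n : nat) :
  \sum_(0 <= i < n.+1 | ~~ odd i) F i = \sum_(0 <= s < n./2.+1) F (2 * s)%N.
Proof.
elim: n => [|n IHn]; first by rewrite !big_mkcond !big_nat1.
rewrite big_mkcond big_nat_recr //= -big_mkcond /= IHn uphalf_half.
case: (boolP (odd n)) => [odd_n | _] /=; last by rewrite addr0.
rewrite add1n [RHS]big_nat_recr //=; congr (_ + F _).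
by rewrite -[in LHS](odd_double_half n) odd_n; lia.
Qed.

Lemma second_difference_expn (R : comNzRingType) (y : R) (n : nat) :
  (y + 1) ^+ n - y ^+ n - (y ^+ n - (y - 1) ^+ n) =
  \sum_(1 <= s < n./2.+1) (2 * 'C(n, 2 * s))%:R * y ^+ (n - 2 * s).
Proof.
have binomial_even : (y + 1) ^+ n + (y - 1) ^+ n =
    \sum_(0 <= s < n./2.+1) (2 * 'C(n, 2 * s))%:R * y ^+ (n - 2 * s).
  rewrite -(sum_even_nat (fun i => (2 * 'C(n, i))%:R * y ^+ (n - i))).
  rewrite exprDn exprBn -big_split [RHS]big_mkcond big_mkord.
  (* The two expansions combine to the factor [1 + (-1) ^+ i]: 2 for even [i], 0 for odd [i]. *)
  apply: eq_bigr => i _; rewrite !expr1n !mulr1 -signr_odd natrM /=.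
  by case: (odd i); rewrite ?expr0 ?expr1; ring.
(* The term [s = 0] is [2 y^n], exactly what the second difference subtracts. *)
rewrite big_nat_recl // bin0 subn0 muln1 in binomial_even.
rewrite big_add1 /=.
by apply: (addrI (2%:R * y ^+ n)); rewrite -binomial_even; ring.
Qed.

(** The inner sum telescopes to [f k.+1 - f k] minus the constant [f 1 - f 0]; the outer sum
    telescopes again and counts that constant [x.-1] times. *)
Lemma sum_second_difference (R : pzRingType) (f : nat -> R) (x : nat) :
  (0 < x)%N ->
  \sum_(1 <= k < x) \sum_(1 <= j < k.+1) (f j.+1 - f j - (f j - f j.-1)) =
  f x - f 1%N - (f 1%N - f 0%N) *+ x.-1.
Proof.
move=> x_gt0.
under eq_bigr => k _.
  rewrite (telescope_sumr (fun j => f j - f j.-1)) //=.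
  over.
by rewrite sumrB telescope_sumr // sumr_const_nat subn1.
Qed.

Theorem theorem2p1 (x n : nat) (hx : (0 < x)%N) (hn : (0 < n)%N) :
  let m : nat := (if odd n then (n - 1) %/ 2 else n %/ 2)%N in
  x%:R ^+ n =
    x%:R + \sum_(1 <= s < m.+1)
      (2 * n`!%:R / ((2 * s)`!%:R * (n - 2 * s)`!%:R)
       * \sum_(1 <= k < x) \sum_(1 <= j < k.+1) j%:R ^+ (n - 2 * s)) :> rat.
Proof.
move=> m.
have -> : m = n./2 by rewrite /m -divn2; case: ifP; lia.
have coefE s : (1 <= s < n./2.+1)%N ->
    2 * n`!%:R / ((2 * s)`!%:R * (n - 2 * s)`!%:R) =
    (2 * 'C(n, 2 * s))%:R :> rat.
  move=> s_bound; have le_2s_n : (2 * s <= n)%N by lia.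
  rewrite -(bin_fact le_2s_n) !natrM mulrA mulfK //.
  by rewrite -natrM pnatr_eq0 -lt0n muln_gt0 !fact_gt0.
under eq_big_nat => s s_bound.
  rewrite coefE // mulr_sumr.
  under eq_bigr => k _ do rewrite mulr_sumr.
  over.
(* With the sum over [s] innermost, each [j] carries a second difference. *)
rewrite exchange_big_nat /=.
under eq_bigr => k _ do rewrite exchange_big_nat /=.
have telescoped := sum_second_difference (fun j => j%:R ^+ n : rat) hx.
rewrite (eq_bigr (fun k => \sum_(1 <= j < k.+1)
    (j.+1%:R ^+ n - j%:R ^+ n - (j%:R ^+ n - j.-1%:R ^+ n)))); last first.
  (* The range excludes [j = 0], where the truncated [j.-1] would differ from [j - 1]. *)
  move=> k _; apply: eq_big_nat => -[|j] // _.
  by rewrite -second_difference_expn -!natr1 addrK.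
(* As [0 < n] gives [0 ^+ n = 0], the constant is 1 and the total is [x^n - 1 - (x - 1)]. *)
rewrite telescoped expr1n expr0n gtn_eqF // subr0 -(prednK hx) /=.
by rewrite -natr1; ring.
Qed.
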